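(* Let $k = 2^t$ for some even integer $t \geq 4$, and let $n \geq 3k+2$ be an integer such that $n \equiv k+2 \pmod{2k}$. Let $L$ be a graph of order $n$ that is a vertex disjoint union of one copy of $K_{\sqrt{k}}$, $\frac{1}{2}\sqrt{k}+1$ copies of $K_2$ and $n-2\sqrt{k}-2$ copies of $K_1$. Then a partial $k$-star decomposition of $K_n$ whose leave is $L$ exists, and furthermore it cannot be embedded in a $k$-star decomposition of $K_{n+s}$ for any nonnegative integer $s < 3k-2$.
   Context: All graphs are finite and simple. A $k$-star is a complete bipartite graph $K_{1,k}$. A $k$-star decomposition of a graph $G$ is a set of $k$-stars that are subgraphs of $G$ such that each edge of $G$ is in exactly one of the $k$-stars. A partial $k$-star decomposition of $G$ is a set of $k$-stars that are subgraphs of $G$ such that each edge of $G$ is in at most one of the $k$-stars; its leave is the graph with vertex set $V(G)$ whose edges are exactly the edges of $G$ that are in none of its $k$-stars. An embedding of a partial $k$-star decomposition $\mathcal{A}$ of a graph $G$ is a partial $k$-star decomposition $\mathcal{B}$ of a graph $H$ such that $\mathcal{A} \subseteq \mathcal{B}$ and $G$ is a subgraph of $H$; we then say $\mathcal{A}$ is embedded in $\mathcal{B}$. $K_m$ denotes the complete graph on $m$ vertices. *)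

(* Defs.v *)
From HB Require Import structures.
From mathcomp Require Import all_boot.

Set Implicit Arguments.
Unset Strict Implicit.
Unset Printing Implicit Defensive.

(* A finite simple graph whose vertices are drawn from an ambient finite type T.
   The vertex set is an arbitrary subset of T, so that graphs of different
   orders (e.g. K_n inside K_(n+s)) and all their subgraphs share one type. *)
Definition is_simple (T : finType) (G : {set T} * {set {set T}}) : bool :=
  [forall e in G.2, (e \subset G.1) && (#|e| == 2)].

Record graph (T : finType) := Graph {
  gval : {set T} * {set {set T}};
  gvalP : is_simple gval
}.

HB.instance Definition _ (T : finType) := [isSub for @gval T].
HB.instance Definition _ (T : finType) := [Finite of graph T by <:].

Definition vertices (T : finType) (G : graph T) : {set T} := (gval G).1.
Definition edges (T : finType) (G : graph T) : {set {set T}} := (gval G).2.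

Definition subgraph (T : finType) (G H : graph T) : bool :=
  (vertices G \subset vertices H) && (edges G \subset edges H).

Fact complete_graph_subproof (T : finType) (V : {set T}) :
  is_simple (V, [set e : {set T} | e \subset V & #|e| == 2]).
Proof. by apply/forall_inP => e /=; rewrite inE. Qed.

Definition complete_graph (T : finType) (V : {set T}) : graph T :=
  Graph (complete_graph_subproof V).

Definition is_complete (T : finType) (m : nat) (G : graph T) : bool :=
  (#|vertices G| == m) && (G == complete_graph (vertices G)).

Definition is_complete_bipartite (T : finType) (a b : nat) (G : graph T) : Prop :=
  exists A B : {set T},
    [/\ [disjoint A & B], #|A| = a, #|B| = b,
        vertices G = A :|: B
      & edges G = [set [set x; y] | x in A, y in B]].

Definition is_star (T : finType) (k : nat) (G : graph T) : Prop :=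
  is_complete_bipartite 1 k G.

Definition stars_at (T : finType) (D : {set graph T}) (e : {set T}) :
    {set graph T} :=
  [set S in D | e \in edges S].

Definition star_decomposition (T : finType) (k : nat) (G : graph T)
    (D : {set graph T}) : Prop :=
  (forall S : graph T, S \in D -> is_star k S /\ subgraph S G) /\
  (forall e : {set T}, e \in edges G -> #|stars_at D e| = 1).

Definition partial_star_decomposition (T : finType) (k : nat) (G : graph T)
    (D : {set graph T}) : Prop :=
  (forall S : graph T, S \in D -> is_star k S /\ subgraph S G) /\
  (forall e : {set T}, e \in edges G -> #|stars_at D e| <= 1).

Fact leave_subproof (T : finType) (G : graph T) (D : {set graph T}) :
  is_simple (vertices G, edges G :\: \bigcup_(S in D) edges S).
Proof.
apply/forall_inP => e /=; rewrite inE => /andP[_ eG].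
exact: (forall_inP (gvalP G)).
Qed.

Definition leave (T : finType) (G : graph T) (D : {set graph T}) : graph T :=
  Graph (leave_subproof G D).

Definition embedding (T : finType) (k : nat) (G : graph T) (A : {set graph T})
    (H : graph T) (B : {set graph T}) : Prop :=
  [/\ partial_star_decomposition k G A, partial_star_decomposition k H B,
      A \subset B & subgraph G H].

Definition vertex_disjoint_union (T : finType) (Gs : seq (graph T))
    (L : graph T) : Prop :=
  [/\ pairwise (fun G1 G2 => [disjoint vertices G1 & vertices G2]) Gs,
      vertices L = \bigcup_(G <- Gs) vertices G
    & edges L = \bigcup_(G <- Gs) edges G].

(* L is a vertex disjoint union of copies of K_m, one for each entry m of ms
   (counted with multiplicity). *)
Definition disjoint_union_of_completes (T : finType) (ms : seq nat)
    (L : graph T) : Prop :=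
  exists2 Gs : seq (graph T),
    all2 (fun m G => is_complete m G) ms Gs & vertex_disjoint_union Gs L.

(* Main.v *)
Require Import Defs.
From mathcomp Require Import all_boot.
From mathcomp Require Import zify.

(** Write k = r^2 with r = 2q, so that k = 4q^2, and n = (2j+1)k + 2 with
    j >= 1.

    Existence. Decomposing K_n - L into k-stars amounts to assigning each edge
    to one of its ends so that every vertex v receives a_v k edges; the edges
    received by v are then cut into a_v stars centred at v. Hall's theorem with
    capacities ([hall_assignment]) says that such an assignment exists as soon
    as the total is right and no vertex set S spans more edges than the sum of
    a_v k over S ([star_decomposition_of_counts]). Let n/2 + j of the vertices,
    chosen arbitrarily, have a_v = j + 1 and the others a_v = j. The total is
    right because L has k/2 + 1 edges. For |S| <= n/2 - j the condition on S is
    |S| - 1 <= 2jk at worst; for larger S one compares with the equality at the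
    full vertex set, removing the vertices outside S, each of which is on at
    most r - 1 edges of L ([capacity_bound]).

    Impossibility. A k-star decomposition of K_(n+s) that contains A induces
    one of the graph J made of L and of all edges that meet the set X of the
    s new vertices. Counting edges, k divides n+s choose 2; as k is a power of
    two, 2k divides n+s or n+s-1, and s < 3k - 2 leaves only s = k - 2 and
    s = k - 1 ([extension_sizes]). Orient every edge of J away from the centre
    of its star: all outdegrees are multiples of k.

    If s = k - 2, both ends of a K_2 of L have degree k - 1 in J, so neither is
    a centre and the edge between them is in no star.

    If s = k - 1, vertices in a K_1 of L have degree k - 1 and are not centres,
    while the ends of a K_2 have degree k, so both being centres would put
    their common edge in two stars. Hence at most r + (r/2 + 1) vertices of L
    are centres ([few_centres]). The vertices of X have degree n + s - 1, a
    multiple of k, so their indegrees are multiples of k too; two of them are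
    joined by an edge, so at most one indegree is 0 and the sum of the indegrees
    over X is at least k(k-2). On the other hand this sum is at most
    (k-1)(k-2)/2 + (k-1)(3r/2 + 1) ([clique_indegree_bound]), which is smaller
    since k >= 16. *)

Set Implicit Arguments.
Unset Strict Implicit.
Unset Printing Implicit Defensive.

(** * Assigning items to places of prescribed capacity *)

Definition hall_condition (I T : finType) (E : {set I}) (d : T -> nat)
    (N : I -> {set T}) : bool :=
  [forall S : {set T}, #|[set i in E | N i \subset S]| <= \sum_(v in S) d v].

Lemma sum_setUI (T : finType) (d : T -> nat) (S1 S2 : {set T}) :
  \sum_(v in S1 :|: S2) d v + \sum_(v in S1 :&: S2) d v
  = \sum_(v in S1) d v + \sum_(v in S2) d v.
Proof.
rewrite !(big_mkcond (fun v => v \in _)) -!big_split; apply: eq_bigr => v _ /=.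
by rewrite !inE; case: (v \in S1); case: (v \in S2); rewrite /= ?addn0 ?add0n.
Qed.

Lemma card_confinedD1 (I T : finType) (E : {set I}) (e : I)
    (N M : I -> {set T}) (S : {set T}) :
  e \in E -> (forall i, i != e -> M i = N i) ->
  #|[set i in E | M i \subset S]|
  = (M e \subset S) + #|[set i in E :\ e | N i \subset S]|.
Proof.
move=> eE MN; rewrite (cardsD1 e) inE eE; congr (_ + _).
by apply: eq_card => i; rewrite !inE; case: eqVneq => //= /MN ->.
Qed.

(** Items confined to S1 and items confined to S2 are all confined to the union,
    and those counted twice are confined to the intersection. *)
Lemma card_confined_supermodular (I T : finType) (E : {set I})
    (N : I -> {set T}) (S1 S2 : {set T}) :
  #|[set i in E | N i \subset S1]| + #|[set i in E | N i \subset S2]|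
  <= #|[set i in E | N i \subset S1 :|: S2]|
     + #|[set i in E | N i \subset S1 :&: S2]|.
Proof.
rewrite -cardsUI; apply: leq_add; apply: subset_leq_card; apply/subsetP => i.
  rewrite !inE => /orP[] /andP[-> sN] /=; apply: subset_trans sN _.
    exact: subsetUl.
  exact: subsetUr.
by rewrite !inE subsetI; case: (i \in E).
Qed.

(** The heart of Rado's proof of Hall's theorem. If deleting x and deleting y both
    violated the condition, at sets S1 and S2, then S1 and S2 would both be
    filled to capacity by the items other than e. By supermodularity so would
    their union and intersection, but the union also confines e. *)
Lemma hall_condition_deletion (I T : finType) (E : {set I}) (d : T -> nat)
    (N : I -> {set T}) (e : I) (x y : T) :
  hall_condition E d N -> e \in E -> x \in N e -> y \in N e -> x != y ->
  exists2 z, z \in N e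
    & hall_condition E d (fun i => if i == e then N e :\ z else N i).
Proof.
move=> hN eE xN yN xy; pose D z i := if i == e then N e :\ z else N i.
have [hx|] := boolP (hall_condition E d (D x)); first by exists x.
have [hy _|] := boolP (hall_condition E d (D y)); first by exists y.
rewrite /hall_condition !negb_forall => /existsP[S2 h2] /existsP[S1 h1].
pose a (S : {set T}) := #|[set i in E :\ e | N i \subset S]|.
pose w (S : {set T}) := \sum_(v in S) d v.
have hall (S : {set T}) : (N e \subset S) + a S <= w S.
  by have := forallP hN S; rewrite (card_confinedD1 _ eE (fun i _ => erefl _)).
have tight z (S : {set T}) :
    ~~ (#|[set i in E | D z i \subset S]| <= w S) ->
  N e :\ z \subset S /\ w S <= a S.
  have DN i : i != e -> D z i = N i by rewrite /D => /negPf->.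
  rewrite -ltnNge (card_confinedD1 _ eE DN) /D eqxx -/(a S).
  have [//|_] := boolP (N e :\ z \subset S).
  by rewrite ltnNge add0n (leq_trans _ (hall S)) ?leq_addl.
have [s1 w1] := tight _ _ h1; have [s2 w2] := tight _ _ h2.
have sU : N e \subset S1 :|: S2.
  apply/subsetP => z zN; rewrite inE; case: (eqVneq z x) => [->|zx].
    by rewrite (subsetP s2) ?orbT // !inE xy.
  by rewrite (subsetP s1) // !inE zx.
have := hall (S1 :|: S2); rewrite sU.
have := leq_trans (leq_addl _ _) (hall (S1 :&: S2)).
have := sum_setUI d S1 S2; rewrite -!/(w _).
have := card_confined_supermodular (E :\ e) N S1 S2; rewrite -!/(a _).
move: (a S1) (a S2) (w S1) (w S2) w1 w2 => a1 a2 d1 d2.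
move: (a _) (a _) (w _) (w _) => aI aU dU dI; clear; lia.
Qed.

(** Hall's theorem with capacities, all of them met exactly. Deleting allowed
    places one at a time preserves the condition until every item has a single
    place left; the condition at singletons then bounds the loads. The result
    is a family of item sets rather than a function from items to places,
    which need not exist when T is empty. *)
Lemma hall_assignment (I T : finType) (E : {set I}) (d : T -> nat)
    (N : I -> {set T}) :
  hall_condition E d N -> #|E| = \sum_v d v ->
  exists F : T -> {set I},
    [/\ forall v i, i \in F v -> i \in E /\ v \in N i,
        forall i, i \in E -> exists! v, i \in F v
      & forall v, #|F v| = d v].
Proof.
have [m] := ubnP (\sum_(i in E) #|N i|).
elim: m N => // m IHm N lt_m hN totE.
have N_gt0 i : i \in E -> 0 < #|N i|.
  move=> iE; rewrite lt0n; apply/negP => /eqP/cards0_eq Ni0.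
  have := forallP hN set0; rewrite big_set0 leqn0 => /eqP/cards0_eq/setP/(_ i).
  by rewrite !inE iE Ni0 sub0set.
have [/exists_inP[e eE Ne]|] := boolP [exists e in E, 1 < #|N e|].
  have [x [y [xN yN xy]]] := card_gt1P Ne.
  have [z zN hD] := hall_condition_deletion hN eE xN yN xy.
  have [|F [FN Funiq Fcard]] := IHm _ _ hD totE.
    apply: leq_trans (ltnSE lt_m); rewrite (bigD1 e) //= eqxx.
    rewrite [X in _ < X](bigD1 e) //= (cardsD1 z (N e)) zN.
    by rewrite add1n addSn ltnS leq_add2l; apply: leq_sum => i /andP[_ /negPf->].
  exists F; split=> // v i /FN[iE]; case: eqP => [->|] // .
  by rewrite !inE => /andP[].
move/exists_inPn => N_le1.
have N1 i : i \in E -> exists v, N i = [set v].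
  move=> iE; apply/cards1P; rewrite eqn_leq N_gt0 // andbT leqNgt.
  exact: N_le1.
pose F v := [set i in E | N i == [set v]].
have FN v i : i \in F v -> i \in E /\ v \in N i.
  by rewrite inE => /andP[-> /eqP->]; rewrite set11.
have Funiq i : i \in E -> exists! v, i \in F v.
  move=> iE; have [v Ni] := N1 i iE; exists v; split=> [|w].
    by rewrite inE iE Ni eqxx.
  by rewrite inE Ni => /andP[_ /eqP/set1_inj].
have Fle v : #|F v| <= d v.
  have := forallP hN [set v]; rewrite big_set1; apply: leq_trans.
  apply: subset_leq_card; apply/subsetP => i; rewrite !inE.
  by case/andP=> -> /eqP->; rewrite subxx.
have totF : \sum_v #|F v| = \sum_v d v.
  rewrite -totE -sum1_card.
  under eq_bigr do rewrite -sum1_card big_mkcond.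
  rewrite exchange_big [RHS]big_mkcond; apply: eq_bigr => i _ /=.
  case: ifP => iE; last by rewrite big1 // => v _; rewrite inE iE.
  have [v [iFv vU]] := Funiq i iE.
  rewrite (bigD1 v) //= iFv big1 // => w wv.
  by case: ifP => // /vU vw; rewrite vw eqxx in wv.
exists F; split=> // v; apply/eqP.
have [_ /esym] := leqif_sum (fun v (_ : true) => leqif_eq (Fle v)).
by rewrite totF eqxx => /forall_inP/(_ v isT).
Qed.

(** * Star decompositions from edge counts *)

Lemma edge_simple (T : finType) (G : graph T) (e : {set T}) :
  e \in edges G -> e \subset vertices G /\ #|e| = 2.
Proof. by move/(forall_inP (gvalP G)) => /andP[-> /eqP]. Qed.

Lemma edge_neq (T : finType) (G : graph T) (x y : T) :
  [set x; y] \in edges G -> x != y.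
Proof. by case/edge_simple=> _; rewrite cards2; case: (x != y). Qed.

Lemma edge_other_end (T : finType) (G : graph T) (e : {set T}) (x : T) :
  e \in edges G -> x \in e -> exists2 y, y != x & e = [set x; y].
Proof.
case/edge_simple=> _ e2 xe; have /cards1P[y ey] : #|e :\ x| == 1.
  by move: e2; rewrite (cardsD1 x) xe add1n => -[->].
exists y; first by have := set11 y; rewrite -ey !inE => /andP[].
by rewrite -ey setD1K.
Qed.

Lemma set2_injr (T : finType) (x : T) : injective (fun y => [set x; y]).
Proof.
move=> y z /setP eq_yz; have := eq_yz y; have := eq_yz z.
by rewrite !inE !eqxx !orbT => /orP[] /eqP-> // /esym/orP[] /eqP.
Qed.

Fact star_subproof (T : finType) (v : T) (Y : {set T}) :
  is_simple (v |: (Y :\ v), [set [set x; y] | x in [set v], y in Y :\ v]).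
Proof.
apply/forall_inP => e /= /imset2P[x y /set1P-> yY ->].
have vy : v != y by move: yY; rewrite !inE eq_sym => /andP[].
by rewrite cards2 vy andbT setUS // sub1set.
Qed.

Definition star (T : finType) (v : T) (Y : {set T}) : graph T :=
  Graph (star_subproof v Y).

Lemma star_is_star (T : finType) (k : nat) (v : T) (Y : {set T}) :
  v \notin Y -> #|Y| = k -> is_star k (star v Y).
Proof.
move=> vY Yk; exists [set v], (Y :\ v).
have YE : Y :\ v = Y by apply/setDidPl; rewrite disjoint_sym disjoints1.
by split; rewrite ?YE ?cards1 ?disjoints1 // /vertices /edges /= YE.
Qed.

(** A star is determined by a centre and any set of edges through it. Only k > 0
    guarantees that the centre is a vertex of G. *)
Lemma star_of_edges (T : finType) (k : nat) (G : graph T) (v : T)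
    (F : {set {set T}}) :
  F \subset edges G -> (forall e, e \in F -> v \in e) -> #|F| = k -> 0 < k ->
  exists S : graph T, [/\ is_star k S, subgraph S G & edges S = F].
Proof.
move=> FG vF Fk k0; pose Y := [set y | [set v; y] \in F].
have FY : F = (fun y => [set v; y]) @: Y.
  apply/setP => e; apply/idP/imsetP => [eF|[y]]; last by rewrite inE => ? ->.
  have [y _ ey] := edge_other_end (subsetP FG e eF) (vF e eF).
  by exists y; rewrite // inE -ey.
have vY : v \notin Y.
  by apply/negP; rewrite inE => /(subsetP FG)/edge_neq; rewrite eqxx.
have Yk : #|Y| = k by rewrite -Fk FY card_imset //; exact: set2_injr.
have YE : Y :\ v = Y by apply/setDidPl; rewrite disjoint_sym disjoints1.
have SF : edges (star v Y) = F by rewrite FY /edges /= YE imset2_set1l.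
exists (star v Y); split=> //; first exact: star_is_star.
rewrite /subgraph SF FG andbT /vertices /= YE.
have FV e : e \in F -> e \subset (gval G).1.
  by move=> /(subsetP FG)/edge_simple[].
have YV y : y \in Y -> [set v; y] \subset (gval G).1 by rewrite inE => /FV.
have [y0 y0Y] : exists y, y \in Y by apply/card_gt0P; rewrite Yk.
rewrite subUset sub1set (subsetP (YV _ y0Y)) ?set21 //=.
by apply/subsetP => y /YV/subsetP; apply; rewrite set22.
Qed.

(** Vertex v is to be the centre of a_v stars. The places to which edges are
    assigned are the stars themselves, encoded as pairs of a vertex v and an
    index below a_v, each of capacity k, so the assignment itself separates the
    stars with a common centre. *)
Lemma star_decomposition_of_counts (T : finType) (k : nat) (G : graph T)
    (a : T -> nat) :
  0 < k -> #|edges G| = \sum_v a v * k ->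
  (forall S : {set T},
     #|[set e in edges G | e \subset S]| <= \sum_(v in S) a v * k) ->
  exists D : {set graph T}, star_decomposition k G D.
Proof.
move=> k0 tot hall; pose slot := {v : T & 'I_(a v)}.
pose N (e : {set T}) : {set slot} := [set p | tag p \in e].
have slot_sum (S : {set T}) :
    \sum_(v in S) a v * k = \sum_(p : slot | tag p \in S) k.
  transitivity (\sum_(v in S) \sum_(i < a v) k).
    by apply: eq_bigr => v _; rewrite sum_nat_const card_ord.
  rewrite (sig_big_dep (fun v => v \in S) (fun v (i : 'I_(a v)) => true)
             (fun v i => k)).
  by apply: eq_bigl => p; rewrite andbT.
(* An edge confined to a set S of places has both ends among the vertices all
   of whose places are in S. *)
have hN : hall_condition (edges G) (fun _ => k) N.
  apply/forallP => S; pose S0 := [set v | [forall i : 'I_(a v), Tagged _ i \in S]].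
  have S0S (p : slot) : tag p \in S0 -> p \in S.
    by case: p => v i; rewrite inE => /forallP/(_ i).
  apply: leq_trans (_ : #|[set e in edges G | e \subset S0]| <= _).
    apply: subset_leq_card; apply/subsetP => e; rewrite !inE => /andP[-> /=].
    move/subsetP=> sN; apply/subsetP => v ve; rewrite inE.
    by apply/forallP => i; apply: sN; rewrite inE.
  apply: leq_trans (hall S0) _; rewrite slot_sum.
  rewrite !sum_nat_const leq_mul2r; apply/orP; right.
  by apply: subset_leq_card; apply/subsetP => p /S0S.
have [|F [FN Funiq Fcard]] := hall_assignment hN.
  rewrite tot; have := slot_sum setT.
  rewrite (eq_bigl xpredT); last by move=> v; rewrite inE.
  by move=> ->; apply: eq_bigl => p; rewrite inE.
have FS p : exists S : graph T, [/\ is_star k S, subgraph S G & edges S = F p].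
  apply: (@star_of_edges _ _ _ (tag p)) => //.
    by apply/subsetP => e /FN[].
  by move=> e /FN[]; rewrite inE.
have [S /all_and3[starS subS edgesS]] := fin_all_exists FS.
exists [set S p | p : slot]; split=> [_ /imsetP[p _ ->] // | e eG].
have [p [eFp pU]] := Funiq e eG; apply/eqP/cards1P; exists (S p).
apply/setP => S'; rewrite !inE; apply/andP/eqP => [[/imsetP[q _ ->]]|->].
  by rewrite edgesS => /pU->.
by rewrite imset_f // edgesS.
Qed.

Lemma star_decomposition_cover (T : finType) (k : nat) (G : graph T)
    (D : {set graph T}) (e : {set T}) :
  star_decomposition k G D -> e \in edges G ->
  exists2 S, S \in D & e \in edges S.
Proof.
move=> [_ D1] /D1/eqP/cards1P[S /setP/(_ S)]; rewrite !inE eqxx.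
by case/andP=> SD eS; exists S.
Qed.

(** * Disjoint unions of complete graphs *)

Definition neighbours (T : finType) (G : graph T) (v : T) : {set T} :=
  [set z | [set v; z] \in edges G].

Lemma card_bigcup_le (T : finType) (I : Type) (s : seq I) (P : pred I)
    (F : I -> {set T}) :
  #|\bigcup_(i <- s | P i) F i| <= \sum_(i <- s | P i) #|F i|.
Proof.
apply: (big_ind2 (fun (A : {set T}) m => #|A| <= m)) => [|A m B p Am Bp|//].
  by rewrite cards0.
by rewrite (leq_trans (leq_card_setU A B)) ?leq_add.
Qed.

Lemma complete_graph_edge (T : finType) (V : {set T}) (x y : T) :
  ([set x; y] \in edges (complete_graph V)) = [&& x \in V, y \in V & x != y].
Proof.
by rewrite inE subUset !sub1set cards2 andbA; case: (x != y).
Qed.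

Lemma card_complete_graph_edges (T : finType) (V : {set T}) :
  #|edges (complete_graph V)| = 'C(#|V|, 2).
Proof. exact: cards_draws. Qed.

Lemma disjoint_edges (T : finType) (G G' : graph T) :
  [disjoint vertices G & vertices G'] -> [disjoint edges G & edges G'].
Proof.
move=> dis; apply/pred0P => e /=; apply/negP => /andP[/edge_simple[eG e2]].
case/edge_simple=> eG' _; have /card_gt0P[x xe] : 0 < #|e| by rewrite e2.
by have := pred0P dis x; rewrite /= (subsetP eG) ?(subsetP eG').
Qed.

(** An edge of the union through a vertex of G could only come from another part
    that shares this vertex with G. *)
Lemma vertex_disjoint_union_edge (T : finType) (Gs : seq (graph T))
    (L G : graph T) (v : T) (e : {set T}) :
  vertex_disjoint_union Gs L -> G \in Gs -> v \in vertices G ->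
  e \in edges L -> v \in e -> e \in edges G.
Proof.
case=> disj _ ->; rewrite bigcup_seq => GGs vG /bigcupP[G' G'Gs eG'] ve.
have vG' : v \in vertices G' by have [/subsetP/(_ v ve)] := edge_simple eG'.
have [->//|GG'] := eqVneq G G'; case/(nthP G): GGs => i ilt Gi.
case/(nthP G): G'Gs => j jlt G'j; have [ij|ji|ij] := ltngtP i j.
- have := pairwiseP G disj i j ilt jlt ij; rewrite Gi G'j => /pred0P/(_ v).
  by rewrite /= vG vG'.
- have := pairwiseP G disj j i jlt ilt ji; rewrite Gi G'j => /pred0P/(_ v).
  by rewrite /= vG vG'.
by rewrite -Gi -G'j ij eqxx in GG'.
Qed.

Lemma card_vertex_disjoint_union_edges (T : finType) (Gs : seq (graph T))
    (L : graph T) :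
  vertex_disjoint_union Gs L -> #|edges L| = \sum_(G <- Gs) #|edges G|.
Proof.
case=> disj _ ->; elim: Gs disj => [_|G Gs IH] /=.
  by rewrite !big_nil cards0.
case/andP=> /allP disG /IH {}IH; rewrite !big_cons -IH; apply/eqP.
rewrite (leq_card_setU _ _) bigcup_seq.
by apply: bigcup_disjoint => G' /disG/disjoint_edges.
Qed.

Lemma all2_mem (A B : eqType) (R : A -> B -> bool) (s : seq A) (t : seq B) y :
  all2 R s t -> y \in t -> exists2 x, x \in s & R x y.
Proof.
elim: s t => [|x s IH] [|z t] //= /andP[Rxz Rst]; rewrite inE => /predU1P[->|].
  by exists x; rewrite ?mem_head.
by case/(IH _ Rst)=> x' x's Rx'; exists x'; rewrite // inE x's orbT.
Qed.

Lemma all2_mem_left (A B : eqType) (R : A -> B -> bool) (s : seq A) (t : seq B) x :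
  all2 R s t -> x \in s -> exists2 y, y \in t & R x y.
Proof.
elim: s t => [|z s IH] [|y t] //= /andP[Rzy Rst]; rewrite inE => /predU1P[->|].
  by exists y; rewrite ?mem_head.
by case/(IH _ Rst)=> y' y't Ry'; exists y'; rewrite // inE y't orbT.
Qed.

Lemma leq_sum_all2 (A B : eqType) (R : A -> B -> bool) (s : seq A) (t : seq B)
    (f : A -> nat) (g : B -> nat) :
  all2 R s t -> {in t, forall y x, R x y -> g y <= f x} ->
  \sum_(y <- t) g y <= \sum_(x <- s) f x.
Proof.
elim: s t => [|x s IH] [|z t] //= => [|/andP[Rxz Rst] gf].
  by rewrite !big_nil.
rewrite !big_cons leq_add ?IH ?gf ?mem_head // => y yt.
by apply: gf; rewrite inE yt orbT.
Qed.

Lemma is_completeP (T : finType) (m : nat) (G : graph T) :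
  is_complete m G ->
  #|vertices G| = m /\ edges G = edges (complete_graph (vertices G)).
Proof. by case/andP=> /eqP Vm /eqP GE; split=> //; rewrite {1}GE. Qed.

Lemma neighbours_in_part (T : finType) (Gs : seq (graph T)) (L G : graph T)
    (m : nat) (v : T) :
  vertex_disjoint_union Gs L -> G \in Gs -> is_complete m G ->
  v \in vertices G -> neighbours L v = vertices G :\ v.
Proof.
move=> UL GGs /is_completeP[_ GE] vG; apply/setP => z; rewrite !inE.
apply/idP/andP => [vzL|[zv zG]].
  have := vertex_disjoint_union_edge UL GGs vG vzL (set21 v z).
  by rewrite GE complete_graph_edge eq_sym => /and3P[].
have [_ _ ->] := UL; rewrite bigcup_seq; apply/bigcupP; exists G => //.
by rewrite GE complete_graph_edge vG zG eq_sym.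
Qed.

Lemma card_neighbours_in_part (T : finType) (Gs : seq (graph T)) (L G : graph T)
    (m : nat) (v : T) :
  vertex_disjoint_union Gs L -> G \in Gs -> is_complete m G ->
  v \in vertices G -> #|neighbours L v| = m.-1.
Proof.
move=> UL GGs Gm vG; rewrite (neighbours_in_part UL GGs Gm vG).
by have [<- _] := is_completeP Gm; rewrite [in RHS](cardsD1 v) vG.
Qed.

Lemma vertex_in_part (T : finType) (Gs : seq (graph T)) (L : graph T) (v : T) :
  vertex_disjoint_union Gs L -> v \in vertices L ->
  exists2 G, G \in Gs & v \in vertices G.
Proof. by case=> _ -> _; rewrite bigcup_seq => /bigcupP[G GGs vG]; exists G. Qed.

Lemma card_edges_union_of_completes (T : finType) (Gs : seq (graph T))
    (ms : seq nat) (L : graph T) :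
  all2 (fun m G => is_complete m G) ms Gs -> vertex_disjoint_union Gs L ->
  #|edges L| = \sum_(m <- ms) 'C(m, 2).
Proof.
move=> msGs /card_vertex_disjoint_union_edges->.
elim: ms Gs msGs => [|m ms IH] [|G Gs] //= => [_|/andP[Gm /IH {}IH]].
  by rewrite !big_nil.
rewrite !big_cons IH; congr (_ + _).
by have [<- ->] := is_completeP Gm; rewrite card_complete_graph_edges.
Qed.

(** * A star decomposition of the complement of a sparse graph *)

Lemma double_bin2 s : 2 * 'C(s, 2) + s = s * s.
Proof. by elim: s => // s; rewrite binS bin1; lia. Qed.

(** The Hall condition in numbers: s and p are the numbers of vertices of S and of
    its vertices of high capacity, c the total number of the latter, and x and y
    the numbers of edges of L inside S and not inside S. For s <= n - c the
    bound p >= 0 suffices. For larger s, writing s = n - u, the difference of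
    the two sides vanishes at u = 0 and is u times a quantity that u <= c makes
    nonnegative. *)
Lemma capacity_bound (q j s p x y : nat) (k := 4 * q ^ 2)
    (n := (2 * j + 1) * k + 2) (c := (2 * j + 1) * (2 * q ^ 2) + 1 + j) :
  1 < q -> 0 < j -> s <= n -> s + c <= p + n ->
  x + y = 2 * q ^ 2 + 1 -> y <= (n - s) * (2 * q - 1) ->
  'C(s, 2) <= (j * s + p) * k + x.
Proof.
move=> q2 j1 sn spc xy yb; rewrite -(leq_pmul2l (isT : 0 < 2)).
rewrite -(leq_add2r s) double_bin2.
pose h := 2 * q ^ 2.
have hk : k = 2 * h by rewrite /k /h; lia.
have jh : j <= j * h by rewrite leq_pmulr // /h muln_gt0 expn_gt0 (ltnW q2).
have h0 : 0 < h by rewrite /h muln_gt0 expn_gt0 (ltnW q2).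
have hjj : h + j <= j * h + 1 by move: j1 h0; clear; nia.
have hj : h <= j * h by rewrite leq_pmull.
have hq : 4 * q <= h + 2 by rewrite /h; clear -q2; nia.
have [small|big] := leqP (s + c) n.
  have : s <= 1 + 2 * j * k.
    by move: small; rewrite /c /n hk -/h; move: jh hj; clear; lia.
  move=> /(leq_mul (leqnn s)); lia.
pose u := n - s; have usn : s + u = n by rewrite /u; lia.
have up : c <= p + u by lia.
have bracket : u + 1 + 2 * j * k + 2 * k + 2 * (2 * q - 1) <= 2 * n.
  have : u <= c by lia.
  rewrite /c /n hk -/h; move: jh hj hjj hq q2 j1; clear; lia.
have nE : n = (2 * j + 1) * k + 2 by [].
have cE : 2 * c = n + 2 * j by rewrite /c nE hk -/h; clear; lia.
have kE : k + 2 = 2 * x + 2 * y by rewrite hk; clear -xy; lia.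
have {}yb : y <= u * (2 * q - 1) by [].
move: (2 * q - 1) yb bracket => g yb /(leq_mul (leqnn u)) bracket.
clear xy hq hjj hj h0 jh sn spc big hk.
clearbody u c n k; clear h q q2 j1.
(* The goal is linear over the products of these equations and bounds by s, u, n,
   jk and k. *)
have := congr1 (muln s) usn; have := congr1 (muln u) usn.
have := congr1 (muln n) usn; have := congr1 (muln n) nE.
have := congr1 (muln (j * k)) usn; have := congr1 (muln k) cE.
have := leq_mul (leqnn k) up.
clear up cE; lia.
Qed.

(** Equality of the total capacity and the number m of edges of K_n - L, which is
    what fixes the number c of vertices of high capacity. *)
Lemma capacity_total (q j m : nat) (k := 4 * q ^ 2)
    (n := (2 * j + 1) * k + 2) (c := (2 * j + 1) * (2 * q ^ 2) + 1 + j) :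
  m + (2 * q ^ 2 + 1) = 'C(n, 2) -> m = (j * n + c) * k.
Proof.
move=> mE; have := double_bin2 n; rewrite -mE.
have nE : n = (2 * j + 1) * k + 2 by [].
have cE : 2 * c = n + 2 * j by rewrite /c nE /k; clear; lia.
have kE : k = 2 * (2 * q ^ 2) by rewrite /k; clear; lia.
clear mE; move: (2 * q ^ 2) kE => h kE; clearbody c n k.
have := congr1 (muln n) nE; have := congr1 (muln k) cE.
clear cE; lia.
Qed.

Lemma card_edges_not_inside (T : finType) (L : graph T) (S : {set T}) :
  #|[set e in edges L | ~~ (e \subset S)]|
  <= \sum_(v in vertices L :\: S) #|neighbours L v|.
Proof.
pose F v := [set [set v; z] | z in neighbours L v].
apply: leq_trans (_ : #|\bigcup_(v in vertices L :\: S) F v| <= _).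
  apply: subset_leq_card; apply/subsetP => e; rewrite inE => /andP[eL].
  case/subsetPn=> v ve vS; have [/subsetP/(_ v ve) vL _] := edge_simple eL.
  apply/bigcupP; exists v; first by rewrite inE vS.
  have [z _ ez] := edge_other_end eL ve.
  by apply/imsetP; exists z; rewrite // inE -ez.
apply: leq_trans (card_bigcup_le _ _ _) _; apply: leq_sum => v _.
exact: leq_imset_card.
Qed.

Lemma exists_subset_card (T : finType) (V : {set T}) (c : nat) :
  c <= #|V| -> exists2 P : {set T}, P \subset V & #|P| = c.
Proof.
rewrite -bin_gt0 -cards_draws => /card_gt0P[P]; rewrite inE => /andP[PV /eqP].
by exists P.
Qed.

(** The vertices of high capacity form an arbitrary set P of c vertices. *)
Lemma star_decomposition_leaving (T : finType) (L : graph T) (q j : nat)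
    (k := 4 * q ^ 2) :
  1 < q -> 0 < j -> #|vertices L| = (2 * j + 1) * k + 2 ->
  #|edges L| = 2 * q ^ 2 + 1 ->
  {in vertices L, forall v, #|neighbours L v| <= 2 * q - 1} ->
  exists A : {set graph T},
    partial_star_decomposition k (complete_graph (vertices L)) A /\
    leave (complete_graph (vertices L)) A = L.
Proof.
move=> q2 j1 nV nE degL; set V := vertices L; set K := complete_graph V.
have LK : edges L \subset edges K.
  apply/subsetP => e /edge_simple[eV /eqP e2].
  by rewrite inE eV.
(* G is K - L: the leave of a family whose only member is L. *)
pose G := leave K [set L].
have GE : edges G = edges K :\: edges L by rewrite {1}/edges /= big_set1.
pose c := (2 * j + 1) * (2 * q ^ 2) + 1 + j.
have [P PV Pc] : exists2 P : {set T}, P \subset V & #|P| = c.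
  by apply: exists_subset_card; rewrite nV /c /k; nia.
pose a v := if v \in V then j + (v \in P) else 0.
have sum_a (S : {set T}) :
    \sum_(v in S) a v * k = (j * #|S :&: V| + #|S :&: P|) * k.
  rewrite -big_distrl /=; congr (_ * _).
  have -> : S :&: P = (S :&: V) :&: P by rewrite -setIA (setIidPr PV).
  rewrite -big_mkcondr /= big_split /= sum_nat_const mulnC -big_mkcondr /=.
  rewrite sum1_card; congr (j * _ + _); apply: eq_card => v; first by rewrite inE.
  by rewrite !inE.
have splitL (S : {set T}) :
    #|[set e in edges L | e \subset S]|
    + #|[set e in edges L | ~~ (e \subset S)]| = 2 * q ^ 2 + 1.
  rewrite -nE -(cardsID [set e : {set T} | e \subset S] (edges L)).
  by congr (_ + _); apply: eq_card => e; rewrite !inE // andbC //.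
have count (S : {set T}) :
    #|[set e in edges G | e \subset S]| + #|[set e in edges L | e \subset S]|
    = 'C(#|S :&: V|, 2).
  rewrite -card_complete_graph_edges.
  rewrite addnC -(cardsID (edges L) (edges (complete_graph (S :&: V)))).
  congr (_ + _); apply: eq_card => e.
    rewrite !inE subsetI; have [/edge_simple[-> /eqP->]|//] := boolP (e \in edges L).
      by rewrite !andbT.
    by rewrite andbF.
  rewrite inE GE !inE subsetI -!andbA; congr (_ && _).
  by case: (e \subset S); case: (e \subset V); rewrite /= ?andbF ?andbT.
have k0 : 0 < k by rewrite /k; nia.
have [||D decD] := @star_decomposition_of_counts _ k G a k0.
- have := sum_a setT; rewrite !setTI nV Pc.
  rewrite (eq_bigl xpredT) => [->|v]; last by rewrite inE.
  apply: capacity_total; rewrite -nV -/V -[in RHS](setTI V) -count.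
  have all_in (H : graph T) : [set e in edges H | e \subset [set: T]] = edges H.
    by apply/setP => e; rewrite inE subsetT andbT.
  by rewrite !all_in nE.
- move=> S; rewrite sum_a -(leq_add2r #|[set e in edges L | e \subset S]|) count.
  apply: (capacity_bound q2 j1) (splitL S) _.
  - by rewrite -nV subset_leq_card ?subsetIr.
  - rewrite -nV -/c -Pc -cardsUI addnC leq_add ?subset_leq_card //.
      by apply/subsetP => v; rewrite !inE => /andP[/andP[-> _] ->].
    by rewrite subUset subsetIr.
  - apply: leq_trans (card_edges_not_inside L S) _.
    apply: leq_trans (_ : \sum_(v in V :\: S) (2 * q - 1) <= _).
      by apply: leq_sum => v; rewrite inE => /andP[_ /degL].
    by rewrite sum_nat_const cardsD setIC nV.
have [starD D1] := decD.
have GK : edges G \subset edges K by rewrite GE subsetDl.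
have coverD : \bigcup_(S in D) edges S = edges G.
  apply/eqP; rewrite eqEsubset; apply/andP; split.
    by apply/bigcupsP => S /starD[_ /andP[]].
  apply/subsetP => e /(star_decomposition_cover decD)[S SD eS].
  by apply/bigcupP; exists S.
have KGL : edges K :\: edges G = edges L.
  by rewrite GE setDDr setDv set0U (setIidPr LK).
exists D; split; last first.
  by apply: val_inj; rewrite /= coverD KGL /vertices /edges /= -surjective_pairing.
split=> [S /starD[starS /andP[SV SE]] | e eK].
  by split=> //; rewrite /subgraph (subset_trans SE) ?andbT.
have [eG|eG] := boolP (e \in edges G); first by rewrite D1.
rewrite leqNgt; apply/negP => /ltnW/card_gt0P[S]; rewrite inE => /andP[SD eS].
by case/negP: eG; rewrite -coverD; apply/bigcupP; exists S.
Qed.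

(** * The orientation carried by a star decomposition *)

Lemma star_decomposition_uniq (T : finType) (k : nat) (G : graph T)
    (D : {set graph T}) (e : {set T}) (S S' : graph T) :
  star_decomposition k G D -> S \in D -> S' \in D -> e \in edges S ->
  e \in edges S' -> S = S'.
Proof.
move=> [D0 D1] SD S'D eS eS'; have [_ /andP[_ /subsetP/(_ e eS) eG]] := D0 S SD.
have /eqP/cards1P[U DU] := D1 e eG.
have : S \in stars_at D e by rewrite inE SD.
have : S' \in stars_at D e by rewrite inE S'D.
by rewrite DU => /set1P-> /set1P->.
Qed.

Lemma leave_star_decomposition (T : finType) (k : nat) (H : graph T)
    (A B : {set graph T}) :
  star_decomposition k H B -> A \subset B ->
  star_decomposition k (leave H A) (B :\: A).
Proof.
move=> decB AB; have [B0 B1] := decB; split=> [S | e].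
  rewrite inE => /andP[SA SB]; have [starS /andP[SV SE]] := B0 S SB.
  split=> //; rewrite /subgraph SV; apply/subsetP => e eS.
  rewrite inE (subsetP SE) // andbT; apply/bigcupP => -[S' S'A eS'].
  have S'B := subsetP AB _ S'A.
  by rewrite (star_decomposition_uniq decB SB S'B eS eS') S'A in SA.
rewrite inE => /andP[eA /B1 <-]; apply: eq_card => S; rewrite !inE.
case: (boolP (S \in A)) => //= SA; symmetry; apply/negP => /andP[_ eS].
by case/negP: eA; apply/bigcupP; exists S.
Qed.

Lemma card_star_edges (T : finType) (k : nat) (S : graph T) :
  is_star k S -> #|edges S| = k.
Proof.
case=> A [B [_ /eqP/cards1P[x ->] <- _ ->]]; rewrite imset2_set1l card_imset //.
exact: set2_injr.
Qed.

(** Double counting of the pairs of an edge and a star through it. *)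
Lemma star_decomposition_dvdn (T : finType) (k : nat) (G : graph T)
    (D : {set graph T}) :
  star_decomposition k G D -> k %| #|edges G|.
Proof.
move=> [D0 D1]; suff -> : #|edges G| = \sum_(S in D) k.
  by rewrite sum_nat_const dvdn_mull.
rewrite -sum1_card -(eq_bigr _ D1).
under eq_bigr do rewrite -sum1dep_card big_mkcondr.
rewrite exchange_big; apply: eq_bigr => S SD; have [starS /andP[_ SE]] := D0 S SD.
rewrite -big_mkcondr /= -(card_star_edges starS) -sum1_card.
by apply: eq_bigl => e; rewrite andb_idl // => /(subsetP SE).
Qed.

(** The edges point from the centre of their star to its leaves. *)
Definition star_orientation (T : finType) (k : nat) (G : graph T)
    (arc : rel T) : Prop :=
  [/\ forall x y, arc x y -> [set x; y] \in edges G,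
      forall x y, [set x; y] \in edges G -> arc x y = ~~ arc y x
    & forall x, k %| #|[set y | arc x y]|].

(** Each edge is in exactly one star, which gives it exactly one direction; the
    edges that leave x are partitioned by the stars centred at x. *)
Lemma star_decomposition_orientation (T : finType) (k : nat) (G : graph T)
    (D : {set graph T}) :
  star_decomposition k G D ->
  exists arc : rel T, star_orientation k G arc.
Proof.
move=> decD; have [D0 D1] := decD.
(* The centre is kept as a singleton, which has set0 as a default value for the
   graphs outside D. *)
have centres S : exists A B : {set T}, S \in D ->
    [/\ #|A| = 1, #|B| = k & edges S = [set [set x; y] | x in A, y in B]].
  have [/D0[[A [B [_ A1 Bk _ SE]]] _]|] := boolP (S \in D); first by exists A, B.
  by exists set0, set0.
have [A /fin_all_exists[B AB]] := fin_all_exists centres.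
pose arc x y := [exists S in D, (A S == [set x]) && (y \in B S)].
have leafE S x y :
    S \in D -> A S = [set x] -> y \in B S -> [set x; y] \in edges S.
  move=> SD Ax yB; have [_ _ ->] := AB S SD; rewrite Ax.
  by apply/imset2P; exists x y; rewrite ?set11.
have arcP x y : arc x y ->
    exists S, [/\ S \in D, A S = [set x], y \in B S & [set x; y] \in edges S].
  case/exists_inP=> S SD /andP[/eqP Ax yB]; exists S; split=> //.
  exact: leafE.
have arcE x y : arc x y -> [set x; y] \in edges G.
  case/arcP=> S [/D0[_ /andP[_ /subsetP SE]] _ _]; exact: SE.
exists arc; split=> // [x y xyE|x].
  have xNy := edge_neq xyE.
  have [S SD xyS] := star_decomposition_cover decD xyE.
  have tot : arc x y || arc y x.
    have [/eqP/cards1P[c Ac] _ SE] := AB S SD.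
    have : [set x; y] \in edges S by [].
    rewrite SE Ac imset2_set1l => /imsetP[b bB /setP eq_xy].
    have := eq_xy x; have := eq_xy y; rewrite !inE !eqxx orbT /=.
    have arcI u v : c = u -> b = v -> arc u v.
      by move=> <- <-; apply/exists_inP; exists S; rewrite // Ac eqxx.
    case/esym/orP=> /eqP yE /esym/orP[] /eqP xE.
    - by rewrite xE yE eqxx in xNy.
    - by rewrite [arc y x]arcI ?orbT.
    - by rewrite [arc x y]arcI.
    by rewrite xE yE eqxx in xNy.
  have asym : ~~ (arc x y && arc y x).
    apply/negP => /andP[/arcP[S1 [S1D A1 _ e1]] /arcP[S2 [S2D A2 _ e2]]].
    rewrite setUC in e2.
    have S12 := star_decomposition_uniq decD S1D S2D e1 e2.
    by move: A2; rewrite -S12 A1 => /set1_inj eq_xy; rewrite eq_xy eqxx in xNy.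
  by case: (arc x y) tot asym; case: (arc y x).
pose F S := if (S \in D) && (A S == [set x]) then B S else set0.
have disF S S' : S != S' -> [disjoint F S & F S'].
  rewrite /F; case: ifP => [/andP[SD /eqP Ax]|]; last by rewrite disjoints_subset sub0set.
  case: ifP => [/andP[S'D /eqP Ax']|]; last by rewrite disjoint_sym disjoints_subset sub0set.
  move=> SS'; apply/pred0P => y /=; apply/negP => /andP[yB yB'].
  by case/eqP: SS'; apply: (star_decomposition_uniq (e := [set x; y]) decD);
     rewrite // leafE.
have -> : [set y | arc x y] = \bigcup_S F S.
  apply/setP => y; rewrite inE; apply/exists_inP/bigcupP => -[S].
    by move=> SD /andP[Ax yB]; exists S; rewrite // /F SD Ax.
  by rewrite /F; case: ifP => [/andP[SD Ax] _ yB|]; rewrite ?inE //; exists S;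
     rewrite // Ax.
rewrite -sum1_card partition_disjoint_bigcup //.
apply: (big_ind (fun m => k %| m)) => [|m p|S _].
- exact: dvdn0.
- exact: dvdn_add.
rewrite sum1_card /F; case: ifP => [/andP[SD _]|]; last by rewrite cards0.
by have [_ -> _] := AB S SD.
Qed.

(** * Degrees in an orientation by stars *)

Lemma outdegree_ge (T : finType) (k : nat) (G : graph T) (arc : rel T) (x y : T) :
  star_orientation k G arc -> arc x y -> k <= #|[set z | arc x z]|.
Proof.
move=> [_ _ dvd_out] xy; apply: dvdn_leq (dvd_out x).
by apply/card_gt0P; exists y; rewrite inE.
Qed.

Lemma outdegree_indegree (T : finType) (k : nat) (G : graph T) (arc : rel T)
    (x : T) :
  star_orientation k G arc ->
  #|[set y | arc x y]| + #|[set y | arc y x]| = #|neighbours G x|.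
Proof.
move=> [arcE arcN _]; rewrite -(cardsID [set y | arc x y] (neighbours G x)).
congr (_ + _); apply: eq_card => y; rewrite !inE.
  by rewrite andb_idl // => /arcE.
apply/idP/andP => [yx|[/negPf nxy xy]]; last first.
  by rewrite (arcN _ _ xy) in nxy; apply: negbFE.
have xyE : [set x; y] \in edges G by rewrite setUC arcE.
by rewrite (arcN _ _ xyE) yx.
Qed.

Lemma out_sub_neighbours (T : finType) (k : nat) (G : graph T) (arc : rel T)
    (x : T) :
  star_orientation k G arc -> [set y | arc x y] \subset neighbours G x.
Proof. by case=> arcE _ _; apply/subsetP => y; rewrite !inE => /arcE. Qed.

Lemma outdegree_le (T : finType) (k : nat) (G : graph T) (arc : rel T)
    (x y : T) :
  star_orientation k G arc -> arc x y -> k <= #|neighbours G x|.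
Proof.
move=> orG xy; apply: leq_trans (outdegree_ge orG xy) _.
exact: subset_leq_card (out_sub_neighbours x orG).
Qed.

(** A vertex of degree at most k that is a centre sends an arc along each
    of its edges. *)
Lemma saturated_arc (T : finType) (k : nat) (G : graph T) (arc : rel T)
    (x y z : T) :
  star_orientation k G arc -> #|neighbours G x| <= k -> arc x z ->
  [set x; y] \in edges G -> arc x y.
Proof.
move=> orG degx xz xy; suff : y \in [set u | arc x u] by rewrite inE.
have /eqP-> : [set u | arc x u] == neighbours G x; last by rewrite inE.
rewrite eqEcard (out_sub_neighbours x orG).
exact: leq_trans degx (outdegree_ge orG xz).
Qed.

(** The indegrees over the clique X are multiples of k, and at most one of them is
    0 because any two vertices of X are joined by an arc. Arcs into X start in X,
    one for each pair, or in W. *)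
Lemma clique_indegree_bound (T : finType) (k : nat) (G : graph T)
    (arc : rel T) (X W : {set T}) :
  star_orientation k G arc ->
  {in X &, forall x y, x != y -> [set x; y] \in edges G} ->
  {in X, forall x, k %| #|neighbours G x|} ->
  {in X, forall x y, arc y x -> (y \in X) || (y \in W)} ->
  2 * (k * #|X|.-1) <= #|X| * #|X|.-1 + 2 * (#|X| * #|W|).
Proof.
move=> orG clique dvd_deg inXW; have [arcE arcN dvd_out] := orG.
pose indeg x := #|[set y | arc y x]|.
have dvd_in x : x \in X -> k %| indeg x.
  by move=> /dvd_deg; rewrite -(outdegree_indegree x orG) dvdn_addr.
pose Z := [set x in X | indeg x == 0].
have Z1 : #|Z| <= 1.
  apply/card_le1_eqP => x y; rewrite !inE => /andP[xX x0] /andP[yX y0].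
  apply/eqP/negPn/negP => yx; have yxE := clique y x yX xX yx.
  have no_in u v : indeg u == 0 -> arc v u = false.
    by move=> /eqP/cards0_eq/setP/(_ v); rewrite !inE.
  by have := arcN y x yxE; rewrite !no_in.
have lower : k * #|X|.-1 <= \sum_(x in X) indeg x.
  apply: leq_trans (_ : \sum_(x in X :\: Z) k <= _).
    rewrite sum_nat_const mulnC leq_mul2r; apply/orP; right.
    rewrite -(cardsID Z X) -subn1 leq_subLR leq_add2r.
    by apply: leq_trans Z1; rewrite subset_leq_card ?subsetIr.
  rewrite [X in _ <= X](big_setID Z) /= -[X in X <= _]add0n leq_add //.
  apply: leq_sum => x; rewrite !inE => /andP[xZ xX].
  by apply: dvdn_leq (dvd_in x xX); rewrite lt0n; move: xZ; rewrite xX.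
have split_in x : x \in X ->
    indeg x <= \sum_(y in X) arc y x + \sum_(y in W) 1.
  move=> xX; rewrite /indeg sum1_card.
  apply: leq_trans (_ : #|[set y in X | arc y x] :|: W| <= _).
    apply: subset_leq_card; apply/subsetP => y; rewrite !inE => yx.
    by rewrite yx andbT; apply: (inXW x).
  apply: leq_trans (leq_card_setU _ _) _; rewrite leq_add2r -sum1dep_card.
  by rewrite big_mkcondr.
have upper : \sum_(x in X) indeg x
    <= \sum_(x in X) \sum_(y in X) arc y x + #|X| * #|W|.
  by rewrite -[#|W|]sum1_card -sum_nat_const -big_split leq_sum.
have inner : 2 * (\sum_(x in X) \sum_(y in X) arc y x) <= #|X| * #|X|.-1.
  rewrite mul2n -addnn {1}exchange_big -big_split /= -sum_nat_const.
  apply: leq_sum => x xX; rewrite -big_split /= (bigD1 x) //=.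
  have -> : arc x x = false.
    by apply/negP => /arcE/edge_neq; rewrite eqxx.
  rewrite add0n (cardsD1 x) xX /= -sum1_card.
  rewrite [X in _ <= X](eq_bigl (fun y => (y \in X) && (y != x))); last first.
    by move=> y; rewrite !inE andbC.
  apply: leq_sum => y /andP[yX yx]; rewrite (arcN x y) ?clique //.
    by case: (arc y x).
  by rewrite eq_sym.
apply: leq_trans (leq_mul (leqnn 2) (leq_trans lower upper)) _.
by rewrite mulnDr leq_add2r.
Qed.

(** * Enlarging the vertex set of a leave *)

Lemma leave_extension_edge (T : finType) (k : nat) (V U : {set T})
    (A : {set graph T}) (x y : T) :
  partial_star_decomposition k (complete_graph V) A -> V \subset U ->
  ([set x; y] \in edges (leave (complete_graph U) A))
  = ([set x; y] \in edges (leave (complete_graph V) A))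
    || [&& x \in U, y \in U, x != y & ~~ ([set x; y] \subset V)].
Proof.
move=> [A0 _] VU; rewrite !in_setD !complete_graph_edge subUset !sub1set negb_and.
case: (boolP ([set x; y] \in \bigcup_(S in A) edges S)) => /= [/bigcupP[S SA]|_].
  have [_ /andP[_ /subsetP SE]] := A0 S SA.
  by move/SE; rewrite complete_graph_edge => /and3P[-> -> _]; rewrite !andbF.
have /implyP := subsetP VU x; have /implyP := subsetP VU y.
by case: (x \in V); case: (y \in V); case: (x \in U); case: (y \in U);
   case: (x == y).
Qed.

Lemma leave_extension_old (T : finType) (k : nat) (V U : {set T})
    (A : {set graph T}) (x : T) :
  partial_star_decomposition k (complete_graph V) A -> V \subset U -> x \in V ->
  neighbours (leave (complete_graph U) A) x
  = neighbours (leave (complete_graph V) A) x :|: (U :\: V).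
Proof.
move=> Adec VU xV; apply/setP => y.
rewrite inE (leave_extension_edge x y Adec VU) !inE (subsetP VU x xV) subUset.
rewrite !sub1set xV /=; congr (_ || _); case: (eqVneq x y) => [<-|]; last first.
  by rewrite andbC.
by rewrite xV andbF.
Qed.

Lemma leave_extension_new (T : finType) (k : nat) (V U : {set T})
    (A : {set graph T}) (x y : T) :
  partial_star_decomposition k (complete_graph V) A -> V \subset U ->
  x \in U :\: V ->
  ([set x; y] \in edges (leave (complete_graph U) A)) = (y \in U) && (y != x).
Proof.
move=> Adec VU; rewrite inE => /andP[/negPf xV xU].
rewrite (leave_extension_edge x y Adec VU) xU subUset !sub1set xV !inE.
by rewrite subUset sub1set xV !andbF /= andbT eq_sym.
Qed.

(** In J a vertex of a part of order m has degree at most m - 1 + |X|. For m = 1 this is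
    less than k; for m = 2 it is at most k, so if both vertices were centres the
    edge between them would have both directions. *)
Lemma few_centres (T : finType) (k : nat) (Gs : seq (graph T)) (ms : seq nat)
    (L J : graph T) (arc : rel T) (X : {set T}) :
  all2 (fun m G => is_complete m G) ms Gs -> vertex_disjoint_union Gs L ->
  star_orientation k J arc -> #|X| < k ->
  {in vertices L, forall x, neighbours J x = neighbours L x :|: X} ->
  #|[set x in vertices L | [exists y, arc x y]]|
  <= \sum_(m <- ms) (if m == 1 then 0 else if m == 2 then 1 else m).
Proof.
move=> msGs UL orJ Xk nbrJ; set W := [set x in _ | _].
have WU : W \subset \bigcup_(G <- Gs) (W :&: vertices G).
  apply/subsetP => x xW; have : x \in vertices L by move: xW; rewrite inE => /andP[].
  case/(vertex_in_part UL) => G GGs xG; rewrite bigcup_seq.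
  by apply/bigcupP; exists G; rewrite // inE xW.
apply: leq_trans (subset_leq_card WU) _.
apply: leq_trans (card_bigcup_le _ _ _) _.
apply: (leq_sum_all2 msGs) => G GGs m Gm; have [Gcard GE] := is_completeP Gm.
have degW x : x \in vertices G -> #|neighbours J x| <= m.-1 + #|X|.
  move=> xG; have xL : x \in vertices L.
    by have [_ -> _] := UL; rewrite bigcup_seq; apply/bigcupP; exists G.
  rewrite nbrJ // -(card_neighbours_in_part UL GGs Gm xG).
  exact: (leq_card_setU _ _).
have outW x : x \in W -> exists y, arc x y by rewrite inE => /andP[_ /existsP].
case: eqP => [m1|_].
  rewrite leqn0; apply/eqP/eq_card0 => x; rewrite inE; apply/negP => /andP[xW xG].
  have [y xy] := outW x xW; have := leq_trans (outdegree_le orJ xy) (degW x xG).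
  by rewrite m1 add0n leqNgt Xk.
case: eqP => [m2|_]; last by rewrite -Gcard subset_leq_card ?subsetIr.
rewrite leqNgt; apply/negP => /card_gt1P[x [y [xW yW xy]]].
have [/andP[{}xW xG] /andP[{}yW yG]] : (x \in W) && (x \in vertices G) /\
    (y \in W) && (y \in vertices G) by split; rewrite -in_setI.
have sat u v : u \in W -> u \in vertices G -> v \in vertices G -> u != v ->
    arc u v /\ [set u; v] \in edges J.
  move=> uW uG vG uv; have [z uz] := outW u uW.
  have uL : u \in vertices L by move: uW; rewrite inE => /andP[].
  have uvJ : [set u; v] \in edges J.
    suff : v \in neighbours J u by rewrite inE.
    by rewrite nbrJ // (neighbours_in_part UL GGs Gm uG) 3!inE vG eq_sym uv.
  split=> //; apply: saturated_arc orJ _ uz uvJ.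
  by apply: leq_trans (degW u uG) _; rewrite m2.
have [xyA xyJ] := sat x y xW xG yG xy.
have [yxA _] : arc y x /\ [set y; x] \in edges J by apply: sat; rewrite // eq_sym.
by have [_ arcN _] := orJ; rewrite (arcN x y xyJ) yxA in xyA.
Qed.

(** * Extensions by fewer than 3k - 2 vertices *)

(** One of two consecutive numbers is odd, hence coprime to the power of two. *)
Lemma dvdn_exp2_mul_pred (u N : nat) :
  2 ^ u %| N * N.-1 -> (2 ^ u %| N) || (2 ^ u %| N.-1).
Proof.
case: N => [|N] /=; first by rewrite dvdn0.
have cop M : odd M -> coprime (2 ^ u) M by move=> ?; rewrite coprimeXl ?coprime2n.
have [/cop/Gauss_dvdl->|evenN] := boolP (odd N); first by move->.
by rewrite Gauss_dvdr ?cop //= => ->; rewrite orbT.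
Qed.

(** Twice the binomial coefficient is (n+s)(n+s-1), so 2k divides one of these two
    factors. Modulo 2k, n + s is k + 2 + s; hence 2k divides k + 2 + s or k + 1 + s,
    and both are less than 4k. *)
Lemma extension_sizes (t j k s : nat) (n := (2 * j + 1) * k + 2) :
  0 < t -> k = 2 ^ t -> k %| 'C(n + s, 2) -> s < 3 * k - 2 ->
  s + 2 = k \/ s + 1 = k.
Proof.
move=> t0 kt dvdC s_lt; have k2 : 1 < k by rewrite kt -(expn0 2) ltn_exp2l.
have : 2 ^ t.+1 %| (n + s) * (n + s).-1.
  have -> : (n + s) * (n + s).-1 = 2 * 'C(n + s, 2).
    by have := double_bin2 (n + s); move: (n + s) => -[|N] /=; lia.
  by rewrite expnS -kt dvdn_pmul2l.
case/dvdn_exp2_mul_pred/orP; rewrite expnS -kt.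
  have -> : n + s = j * (2 * k) + (k + 2 + s) by rewrite /n; lia.
  rewrite (dvdn_addr _ (dvdn_mull j (dvdnn (2 * k)))) => /dvdnP[c cE]; left.
  have c2 : c < 2 by move: s_lt k2 cE; clear; nia.
  by case: c cE c2 => [|[|c]] //; lia.
have -> : (n + s).-1 = j * (2 * k) + (k + 1 + s) by rewrite /n; lia.
rewrite (dvdn_addr _ (dvdn_mull j (dvdnn (2 * k)))) => /dvdnP[c cE]; right.
have c2 : c < 2 by move: s_lt k2 cE; clear; nia.
by case: c cE c2 => [|[|c]] //; lia.
Qed.

Lemma sum_orders (f : nat -> nat) (r a b : nat) :
  \sum_(m <- r :: nseq a 2 ++ nseq b 1) f m = f r + (f 2 * a + f 1 * b).
Proof. by rewrite big_cons big_cat !big_nseq /= !iter_addn_0. Qed.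

(** The left side is (k-1)(k+6q), and 6q + 4 <= k. *)
Lemma too_few_indegrees (q : nat) (k := 4 * q ^ 2) :
  1 < q ->
  (k - 1) * (k - 2) + 2 * ((k - 1) * (2 * q + (q + 1))) < 2 * (k * (k - 2)).
Proof.
move=> q2; have : 6 * q + 4 <= k by rewrite /k; clear k; nia.
clearbody k => hk; have k4 : 4 <= k by lia.
have : (k - 1) * (6 * q + 4) <= (k - 1) * k by rewrite leq_mul2l hk orbT.
have [m ->] : exists m, k = m + 4 by exists (k - 4); lia.
have -> : m + 4 - 1 = m + 3 by lia.
have -> : m + 4 - 2 = m + 2 by lia.
by clear; lia.
Qed.

(** The sum over ms is the bound on the number of centres among the old vertices;
    see the opening comment for the two cases s = k - 2 and s = k - 1. *)
Lemma no_small_extension (T : finType) (t j q k s : nat)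
    (L H : graph T) (Gs : seq (graph T)) (ms : seq nat) (A B : {set graph T}) :
  0 < t -> k = 2 ^ t -> 1 < q -> k = 4 * q ^ 2 ->
  #|vertices L| = (2 * j + 1) * k + 2 ->
  all2 (fun m G => is_complete m G) ms Gs -> vertex_disjoint_union Gs L ->
  2 \in ms ->
  \sum_(m <- ms) (if m == 1 then 0 else if m == 2 then 1 else m)
    = 2 * q + (q + 1) ->
  partial_star_decomposition k (complete_graph (vertices L)) A ->
  leave (complete_graph (vertices L)) A = L ->
  s < 3 * k - 2 -> is_complete (#|vertices L| + s) H ->
  star_decomposition k H B -> A \subset B -> vertices L \subset vertices H ->
  False.
Proof.
move=> t0 kt q2 kq nV msGs UL ms2 cap Adec AL s_lt /andP[/eqP Hcard /eqP HE].
move=> Bdec AB VU; set V := vertices L in nV Adec AL Hcard VU *.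
set U := vertices H in HE Hcard VU *.
pose X := U :\: V; pose J := leave H A.
have Xs : #|X| = s.
  have := cardsID V U; rewrite (setIidPr VU) Hcard => /eqP.
  by rewrite eqn_add2l => /eqP.
have [arc orJ] := star_decomposition_orientation (leave_star_decomposition Bdec AB).
have Jold x : x \in V -> neighbours J x = neighbours L x :|: X.
  by move=> xV; rewrite /J HE (leave_extension_old Adec VU xV) AL.
have Jnew x y : x \in X -> ([set x; y] \in edges J) = (y \in U) && (y != x).
  by move=> xX; rewrite /J HE (leave_extension_new _ Adec VU xX).
have [G GGs G2] := all2_mem_left msGs ms2.
have /eqP/cards2P[a [b [ab Gab]]] := (is_completeP G2).1.
have aG : a \in vertices G by rewrite Gab set21.
have bG : b \in vertices G by rewrite Gab set22.
have inV x : x \in vertices G -> x \in V.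
  by rewrite /V; case: UL => _ -> _ xG; rewrite bigcup_seq; apply/bigcupP; exists G.
have degG x : x \in vertices G -> #|neighbours J x| <= s.+1.
  move=> xG; rewrite Jold ?inV // -Xs.
  by rewrite (leq_trans (leq_card_setU _ _)) // (card_neighbours_in_part UL GGs G2 xG).
have abJ : [set a; b] \in edges J.
  suff : b \in neighbours J a by rewrite inE.
  rewrite Jold ?inV // inE (neighbours_in_part UL GGs G2 aG) in_setD1 bG.
  by rewrite eq_sym ab.
have [arcE arcN _] := orJ.
(* One end of the copy of K_2 must be a centre, of degree s + 1; this excludes
   s = k - 2. *)
have k_le : k <= s.+1.
  have [ba|nba] := boolP (arc b a).
    exact: leq_trans (outdegree_le orJ ba) (degG b bG).
  have ab' : arc a b by rewrite (arcN _ _ abJ).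
  exact: leq_trans (outdegree_le orJ ab') (degG a aG).
have dvdC : k %| 'C((2 * j + 1) * k + 2 + s, 2).
  have := star_decomposition_dvdn Bdec; rewrite HE card_complete_graph_edges.
  by rewrite -/U Hcard nV.
have [sk|sk] := extension_sizes t0 kt dvdC s_lt.
  by move: k_le; rewrite -sk addn2 ltnn.
have Xk : #|X| < k by rewrite Xs -sk addn1.
have := few_centres msGs UL orJ Xk Jold; rewrite cap.
set W := [set x in _ | _] => centres.
have clique : {in X &, forall x y, x != y -> [set x; y] \in edges J}.
  move=> x y xX yX xy; rewrite Jnew // eq_sym xy andbT.
  by move: yX; rewrite inE => /andP[].
(* New vertices have degree n + s - 1 = (2j+2)k. *)
have dvd_deg : {in X, forall x, k %| #|neighbours J x|}.
  move=> x xX; have -> : neighbours J x = U :\ x.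
    by apply/setP => y; rewrite [LHS]inE Jnew // in_setD1 andbC.
  have xU : x \in U by move: xX; rewrite inE => /andP[].
  have := cardsD1 x U; rewrite xU Hcard nV add1n => /eqP.
  have -> : (2 * j + 1) * k + 2 + s = ((2 * j + 2) * k).+1.
    by move: sk; clear; lia.
  by rewrite eqSS => /eqP <-; rewrite dvdn_mull.
have inXW : {in X, forall x y, arc y x -> (y \in X) || (y \in W)}.
  move=> x xX y yx; have xyJ : [set x; y] \in edges J by rewrite setUC arcE.
  have yU : y \in U by move: xyJ; rewrite Jnew // => /andP[].
  rewrite 2!inE yU andbT orbC; case: (boolP (y \in V)) => //= _.
  by rewrite orbF; apply/existsP; exists x.
have := clique_indegree_bound orJ clique dvd_deg inXW.
have sE : s = k - 1 by rewrite -sk addn1 subn1.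
have := too_few_indegrees q2; rewrite -kq Xs sE -subn1 -subnDA.
have := leq_mul (leqnn (k - 1)) centres; move: #|W| => w; clear; lia.
Qed.

Theorem lemma16 (t k r n : nat)
    (ht : 4 <= t) (ht_even : ~~ odd t) (hk : k = 2 ^ t)
    (hr : r ^ 2 = k)
    (hn : 3 * k + 2 <= n) (hn_mod : n = k + 2 %[mod 2 * k])
    (T : finType) (L : graph T)
    (hL_order : #|vertices L| = n)
    (hL : disjoint_union_of_completes
            (r :: nseq (r %/ 2 + 1) 2 ++ nseq (n - 2 * r - 2) 1) L) :
  (exists A : {set graph T},
      partial_star_decomposition k (complete_graph (vertices L)) A /\
      leave (complete_graph (vertices L)) A = L) /\
  (forall A : {set graph T},
      partial_star_decomposition k (complete_graph (vertices L)) A ->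
      leave (complete_graph (vertices L)) A = L ->
      forall s : nat, s < 3 * k - 2 ->
      forall H : graph T, is_complete (n + s) H ->
      ~ exists B : {set graph T},
          star_decomposition k H B /\
          embedding k (complete_graph (vertices L)) A H B).
Proof.
have t0 : 0 < t by apply: leq_trans ht.
have k16 : 16 <= k by rewrite hk (leq_pexp2l (m := 2) (n1 := 4)).
(* r is even because its square is. *)
have [q rq] : exists q, r = 2 * q.
  exists r./2; rewrite mul2n -[LHS]odd_double_half.
  suff -> : odd r = false by [].
  by have := congr1 odd hr; rewrite hk !oddX /= orbF eqn0Ngt t0.
have kq : k = 4 * q ^ 2 by rewrite -hr rq expnMn.
have q2 : 1 < q by move: k16; rewrite kq; case: q {rq kq} => [|[|q]].
have [j j0 nE] : exists2 j, 0 < j & n = (2 * j + 1) * k + 2.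
  have kn : k + 2 <= n by apply: leq_trans hn; lia.
  have /dvdnP[j jE] : 2 * k %| n - (k + 2).
    by rewrite -eqn_mod_dvd //; apply/eqP.
  have nE : n = (2 * j + 1) * k + 2 by move: jE kn; clear; lia.
  by exists j => //; case: j nE {jE} => // nE; lia.
have [Gs msGs UL] := hL; rewrite rq mulKn // in msGs.
split.
  rewrite kq; apply: (star_decomposition_leaving q2 j0); rewrite -?kq ?hL_order //.
    rewrite (card_edges_union_of_completes msGs UL) sum_orders.
    rewrite /= binn [X in X * (_ - _)]bin_small // mul1n mul0n addn0 -mulnn.
    by have := double_bin2 (2 * q); move: 'C(_, _) => C; clear; lia.
  move=> v vL; have [G GGs vG] := vertex_in_part UL vL.
  have [m m_ms Gm] := all2_mem msGs GGs.
  rewrite (card_neighbours_in_part UL GGs Gm vG).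
  move: m_ms; rewrite inE mem_cat !mem_nseq => /predU1P[->|]; first by lia.
  by case/orP=> /andP[_ /eqP->]; move: q2; clear; lia.
move=> A Adec AL s s_lt H Hcomp [B [Bdec [_ _ AB /andP[VH _]]]].
rewrite -hL_order in Hcomp nE.
apply: (no_small_extension t0 hk q2 kq nE msGs UL _ _ Adec AL s_lt Hcomp Bdec AB VH).
  by rewrite inE mem_cat mem_nseq addn1 eqxx /= orbT.
rewrite sum_orders /= mul1n mul0n addn0.
case: eqP => [|_]; first by move: q2; clear; lia.
by case: eqP => [|_]; first by move: q2; clear; lia.
Qed.
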